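(* Let $\Phi=(\{E_i\}_{i=0}^d;\{E^*_i\}_{i=0}^d)$ be a symmetric idempotent system on $V$, with associated scalars $\nu$, $k_i$ and bilinear form $\langle\,,\,\rangle$. For nonzero $\xi,\zeta$ in $E_0V$ the following are equivalent: (i) the bases $\{E^*_i\xi\}_{i=0}^d$ and $\{k_i^{-1}E^*_i\zeta\}_{i=0}^d$ of $V$ are dual with respect to $\langle\,,\,\rangle$; (ii) $\xi,\zeta$ are partners.
   Context: $\mathbb{F}$ is a field, $d\ge 0$ an integer, $V$ a vector space over $\mathbb{F}$ of dimension $d+1$, $\mathrm{End}(V)$ the $\mathbb{F}$-algebra of linear maps $V\to V$; $\mathrm{tr}$ means trace. An antiautomorphism of an algebra $\mathcal{A}$ is an $\mathbb{F}$-linear bijection $\tau:\mathcal{A}\to\mathcal{A}$ with $(YZ)^\tau=Z^\tau Y^\tau$. Idempotent system on $V$: a sequence $\Phi=(\{E_i\}_{i=0}^d;\{E^*_i\}_{i=0}^d)$ of elements of $\mathrm{End}(V)$ such that $E_iE_j=\delta_{i,j}E_i$, $\mathrm{rank}(E_i)=1$, $E^*_iE^*_j=\delta_{i,j}E^*_i$, $\mathrm{rank}(E^*_i)=1$, $E_0E^*_iE_0\neq 0$, $E^*_0E_iE^*_0\ne 0$ for $0\le i,j\le d$. It is symmetric if there is an antiautomorphism $\dagger$ of $\mathrm{End}(V)$ fixing each $E_i$ and each $E^*_i$; such $\dagger$ is unique. $\mathcal{M}$ (resp. $\mathcal{M}^*$) is the subalgebra of $\mathrm{End}(V)$ generated by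 $\{E_i\}_{i=0}^d$ (resp. $\{E^*_i\}_{i=0}^d$); these elements form a basis of it. $\nu=\mathrm{tr}(E_0E^*_0)^{-1}$ (this trace is nonzero). $\rho^*:\mathcal{M}^*\to\mathcal{M}$ is the unique $\mathbb{F}$-linear map with $ZE_0E^*_0=Z^{\rho^*}E^*_0$ for all $Z\in\mathcal{M}^*$. For $0\le i\le d$, $A_i=\nu(E^*_i)^{\rho^*}\in\mathcal{M}$, and $k_i$ is the scalar with $A_iE_0=k_iE_0$; each $k_i$ is nonzero. $\langle\,,\,\rangle$ is a fixed nonzero bilinear form on $V$ such that $\langle Au,v\rangle=\langle u,A^\dagger v\rangle$ for all $u,v\in V$, $A\in\mathrm{End}(V)$ (it exists, is nondegenerate, symmetric, and unique up to a nonzero scalar factor). Write $\|v\|^2=\langle v,v\rangle$. Bases $\{u_i\}_{i=0}^d,\{v_i\}_{i=0}^d$ of $V$ are dual with respect to $\langle\,,\,\rangle$ if $\langle u_i,v_j\rangle=\delta_{i,j}$ for $0\le i,j\le d$. For $0\neq\xi\in E_0V$, one has $\|\xi\|^2\ne0$ and $\{E^*_i\xi\}_{i=0}^d$ is a basis of $V$. For nonzero $\xi,\zeta\in E_0V$ the conditions $\langle\xi,\zeta\rangle=\nu$, $\zeta=\nu\xi/\|\xi\|^2$, $\xi=\nu\zeta/\|\zeta\|^2$ are equivalent; $\xi,\zeta$ are called partners when they hold. *)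

(* Defs.v *)
From HB Require Import structures.
From mathcomp Require Import all_boot all_order all_algebra.
Set Implicit Arguments.
Unset Strict Implicit.
Unset Printing Implicit Defensive.
Import GRing.Theory.
Local Open Scope ring_scope.

(* The product YZ of End(V) is the functional composition (Y \o Z)%VF, so that
   (Y \o Z)%VF v = Y (Z v); the identity of End(V) is \1%VF. *)

Definition lfun_rank (F : fieldType) (V : vectType F) (f : 'End(V)) : nat :=
  \dim (limg f).

(* passmx.mxof is the matrix acting on row vectors, i.e. the transpose of the usual
   one; the trace is unaffected, and does not depend on the basis. *)
Definition lfun_trace (F : fieldType) (V : vectType F) (f : 'End(V)) : F :=
  \tr (passmx.mxof (vbasis {:V}) (vbasis {:V}) f).

Record idempotent_system (F : fieldType) (V : vectType F) (d : nat) :=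
  IdempotentSystem {
    idE : 'I_d.+1 -> 'End(V);
    idEs : 'I_d.+1 -> 'End(V);
    idE_orth : forall i j, (idE i \o idE j)%VF = (i == j)%:R *: idE i;
    idE_rank : forall i, lfun_rank (idE i) = 1%N;
    idEs_orth : forall i j, (idEs i \o idEs j)%VF = (i == j)%:R *: idEs i;
    idEs_rank : forall i, lfun_rank (idEs i) = 1%N;
    idE0EsE0_neq0 : forall i, (idE ord0 \o idEs i \o idE ord0)%VF <> 0;
    idEs0EEs0_neq0 : forall i, (idEs ord0 \o idE i \o idEs ord0)%VF <> 0
  }.

Definition antiautomorphism (F : fieldType) (V : vectType F)
    (tau : {linear 'End(V) -> 'End(V)}) : Prop :=
  bijective tau /\ forall Y Z : 'End(V), tau (Y \o Z)%VF = (tau Z \o tau Y)%VF.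

(* Phi is symmetric when such a map exists; it is then unique. *)
Definition is_dagger (F : fieldType) (V : vectType F) (d : nat)
    (Phi : idempotent_system V d) (dagger : {linear 'End(V) -> 'End(V)}) : Prop :=
  [/\ antiautomorphism dagger,
      forall i, dagger (idE Phi i) = idE Phi i
    & forall i, dagger (idEs Phi i) = idEs Phi i].

Definition is_subalgebra (F : fieldType) (V : vectType F)
    (A : {vspace 'End(V)}) : Prop :=
  \1%VF \in A /\ forall Y Z, Y \in A -> Z \in A -> (Y \o Z)%VF \in A.

Definition is_generated_by (F : fieldType) (V : vectType F) (I : Type)
    (A : {vspace 'End(V)}) (X : I -> 'End(V)) : Prop :=
  [/\ is_subalgebra A, forall i, X i \in A
    & forall B : {vspace 'End(V)},
        is_subalgebra B -> (forall i, X i \in B) -> (A <= B)%VS].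

Definition nu (F : fieldType) (V : vectType F) (d : nat)
    (Phi : idempotent_system V d) : F :=
  (lfun_trace (idE Phi ord0 \o idEs Phi ord0)%VF)^-1.

Definition is_rhos (F : fieldType) (V : vectType F) (d : nat)
    (Phi : idempotent_system V d) (M Ms : {vspace 'End(V)})
    (rhos : {linear subvs_of Ms -> subvs_of M}) : Prop :=
  forall Z : subvs_of Ms,
    (vsval Z \o idE Phi ord0 \o idEs Phi ord0)%VF =
    (vsval (rhos Z) \o idEs Phi ord0)%VF.

(* vsproj Ms only coerces E*_i into the type subvs_of Ms: E*_i belongs to Ms
   when Ms is the subalgebra generated by the E*_i. *)
Definition Amap (F : fieldType) (V : vectType F) (d : nat)
    (Phi : idempotent_system V d) (M Ms : {vspace 'End(V)})
    (rhos : {linear subvs_of Ms -> subvs_of M}) (i : 'I_d.+1) : 'End(V) :=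
  nu Phi *: vsval (rhos (vsproj Ms (idEs Phi i))).

Definition is_invariant_form (F : fieldType) (V : vectType F)
    (dagger : {linear 'End(V) -> 'End(V)})
    (form : {bilinear V -> V -> F | *%R & *%R}) : Prop :=
  (exists u v, form u v <> 0) /\
  forall (A : 'End(V)) u v, form (A u) v = form u (dagger A v).

Definition is_basis (F : fieldType) (V : vectType F) (n : nat)
    (u : 'I_n -> V) : Prop :=
  basis_of {:V} [seq u i | i <- enum 'I_n].

Definition dual_bases (F : fieldType) (V : vectType F) (n : nat)
    (form : {bilinear V -> V -> F | *%R & *%R}) (u v : 'I_n -> V) : Prop :=
  [/\ is_basis u, is_basis v & forall i j, form (u i) (v j) = (i == j)%:R].

(* For nonzero xi, zeta in E_0 V these three conditions are equivalent. *)
Definition partners (F : fieldType) (V : vectType F) (d : nat)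
    (Phi : idempotent_system V d)
    (form : {bilinear V -> V -> F | *%R & *%R}) (xi zeta : V) : Prop :=
  [/\ form xi zeta = nu Phi,
      zeta = (nu Phi / form xi xi) *: xi
    & xi = (nu Phi / form zeta zeta) *: zeta].

(* Main.v *)
Require Import Defs.
From HB Require Import structures.
From mathcomp Require Import all_boot all_order all_algebra.
Set Implicit Arguments.
Unset Strict Implicit.
Unset Printing Implicit Defensive.
Import GRing.Theory passmx.
Local Open Scope ring_scope.

(** Everything happens on the line E_0 V, which is spanned by xi. Let m_i be the
    scalar by which E_0 E*_i acts on that line; it is nonzero because
    E_0 E*_i E_0 is.

    The Gram matrix: dagger fixes the idempotents, so E*_i and E_0 are
    self-adjoint for the form, whence
      <E*_i xi, E*_j zeta> = delta_ij <E_0 xi, E*_i zeta>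
                           = delta_ij <xi, E_0 E*_i zeta>
                           = delta_ij m_i <xi, zeta>.

    The normalisation: k_i = nu m_i with nu <> 0. Indeed E_0 E*_0 is a map
    with image in the line E_0 V, so its trace is the eigenvalue m_0 and
    nu = m_0^-1 ([lfun_trace_line]). As to k_i, the operator B = rho*(E*_i)
    commutes with E_0, since M lies in the commutant of E_0
    ([generated_commutes]); applying E_0 to E*_i E_0 E*_0 xi = B E*_0 xi gives
    m_0 m_i xi = m_0 B xi ([Amap_eigenvalue]).

    Hence <E*_i xi, k_j^-1 E*_j zeta> = delta_ij nu^-1 <xi, zeta>, so the two
    families are biorthogonal exactly when <xi, zeta> = nu, and biorthogonal
    families of d+1 vectors are bases ([biorthogonal_basis]). On a line,
    <xi, zeta> = nu is in turn the same as being partners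
    ([partners_line]). *)

Lemma functionals_basis (F : fieldType) (V : vectType F) (n : nat)
    (dimV : \dim {:V} = n) (u : 'I_n -> V) (phi : 'I_n -> {scalar V})
    (phi_u : forall i j, phi i (u j) = (i == j)%:R) :
  is_basis u.
Proof.
rewrite /is_basis basisEfree subvf dimV size_map size_enum_ord leqnn !andbT.
have uE (j : 'I_n) : [seq u i | i <- enum 'I_n]`_j = u j.
  by rewrite (nth_map j) ?size_enum_ord // nth_ord_enum.
rewrite -[X in free X]/(tval [tuple u i | i < n]).
apply/freeP => c sum0 i; have := congr1 (phi i) sum0.
rewrite linear0 linear_sum (bigD1 i) //= big1 ?addr0 => [|j ji].
  by rewrite uE linearZ /= phi_u eqxx mulr1.
by rewrite uE linearZ /= phi_u eq_sym (negPf ji) mulr0.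
Qed.

Lemma biorthogonal_basis (F : fieldType) (V : vectType F) (n : nat)
    (dimV : \dim {:V} = n) (form : {bilinear V -> V -> F | *%R & *%R})
    (u v : 'I_n -> V) :
  (forall i j, form (u i) (v j) = (i == j)%:R) -> dual_bases form u v.
Proof.
move=> uv; split=> //.
  apply: (functionals_basis dimV (phi := fun i => applyr form (v i))) => i j.
  by rewrite /= /applyr_head uv eq_sym.
exact: (functionals_basis dimV (phi := fun i => form (u i))).
Qed.

(** Every row of the matrix of f is a multiple of the coordinate row r of w,
    so the matrix is c *m r for a column c, with trace r *m c = a. *)
Lemma lfun_trace_line (F : fieldType) (V : vectType F) (f : 'End(V))
    (w : V) (a : F) :
  w != 0 -> (forall v, f v \in <[w]>%VS) -> f w = a *: w -> lfun_trace f = a.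
Proof.
move=> w0 fw fwa; rewrite /lfun_trace.
set e := vbasis {:V}; have eB : basis_of {:V} e := vbasisP _.
set A := mxof e e f; set r := rVof e w.
have [c Ac] : exists c : 'cV_(\dim {:V}), A = c *m r.
  suff /submxP[c Ac] : (A <= r)%MS by exists c.
  apply/row_subP => i; rewrite rowE mul_mxof.
  by have /vlineP[b ->] := fw (vecof e (delta_mx 0 i)); rewrite linearZ scalemx_sub.
have r0 : r != 0 by rewrite rVof_eq0.
rewrite Ac mxtrace_mulC trace_mx11.
have : r *m c *m r = a *: r.
  by rewrite -mulmxA -Ac -rVof_app // fwa linearZ.
rewrite {1}[r *m c]mx11_scalar mul_scalar_mx => /eqP.
by rewrite -subr_eq0 -scalerBl scaler_eq0 (negPf r0) orbF subr_eq0 => /eqP.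
Qed.

(** The commutant of C is a subspace (the kernel of Y |-> YC - CY) and a
    subalgebra, so minimality of the generated algebra applies to it. *)
Lemma generated_commutes (F : fieldType) (V : vectType F) (I : Type)
    (A : {vspace 'End(V)}) (X : I -> 'End(V)) (C : 'End(V)) :
    is_generated_by A X -> (forall i, (X i \o C = C \o X i)%VF) ->
  forall Y, Y \in A -> (Y \o C = C \o Y)%VF.
Proof.
case=> _ _ minA XC Y YA.
pose g (Z : 'End(V)) : 'End(V) := (Z \o C)%VF - (C \o Z)%VF.
have g_lin : linear g.
  move=> a Z1 Z2; rewrite /g comp_lfunDl comp_lfunDr -comp_lfunZl -comp_lfunZr.
  by rewrite scalerBr opprD addrACA.
pose gL := GRing.isLinear.Build _ _ _ _ g g_lin.
pose gl : {linear 'End(V) -> 'End(V)} := HB.pack g gL.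
have kerE Z : (Z \in lker (linfun gl)) = ((Z \o C)%VF == (C \o Z)%VF).
  by rewrite memv_ker lfunE /= /g subr_eq0.
apply/eqP; rewrite -kerE; apply: subvP Y YA; apply: minA => [|i]; last first.
  by rewrite kerE XC.
split=> [|Y Z]; first by rewrite kerE comp_lfun1l comp_lfun1r.
rewrite !kerE => /eqP YC /eqP ZC.
by rewrite -comp_lfunA ZC comp_lfunA YC comp_lfunA.
Qed.

Lemma rank1_limg (F : fieldType) (V : vectType F) (f : 'End(V)) (w : V) :
  lfun_rank f = 1%N -> w \in limg f -> w != 0 -> limg f = <[w]>%VS.
Proof.
move=> rk wf w0; apply/esym/eqP.
by rewrite eqEdim -memvE wf /= dim_vline w0 -[\dim _]/(lfun_rank f) rk.
Qed.

Section IdempotentSystem.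

Variables (F : fieldType) (V : vectType F) (d : nat).
Variable Phi : idempotent_system V d.
Local Notation E0 := (idE Phi ord0).
Local Notation Es := (idEs Phi).

Lemma E0_fixes (v : V) : v \in limg E0 -> E0 v = v.
Proof.
by move=> /memv_imgP[u _ ->]; rewrite -comp_lfunE idE_orth eqxx scale1r.
Qed.

Lemma E0_line (xi v : V) : xi \in limg E0 -> xi != 0 -> E0 v \in <[xi]>%VS.
Proof.
by move=> xi_in xi0; rewrite -(rank1_limg (idE_rank Phi ord0)) ?memv_img ?memvf.
Qed.

Lemma E0Es_eigenvalue (xi : V) :
    xi \in limg E0 -> xi != 0 ->
  exists2 m : 'I_d.+1 -> F, forall i, m i != 0
    & forall i v, v \in limg E0 -> E0 (Es i v) = m i *: v.
Proof.
move=> xi_in xi0.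
have eig i : {a : F | E0 (Es i xi) == a *: xi}.
  by apply: sigW; have /vlineP[a ->] := E0_line (Es i xi) xi_in xi0; exists a.
pose m i := sval (eig i).
have mE i v : v \in limg E0 -> E0 (Es i v) = m i *: v.
  rewrite (rank1_limg (idE_rank Phi ord0) xi_in xi0) => /vlineP[b ->].
  by rewrite !linearZ /= (eqP (svalP (eig i))) !scalerA mulrC.
exists m => // i; apply/negP => /eqP m0.
apply: (@idE0EsE0_neq0 _ _ _ Phi i); apply/lfunP => v.
by rewrite !comp_lfunE mE ?memv_img ?memvf // m0 scale0r lfunE.
Qed.

Lemma nu_eigenvalue (xi : V) (a : F) :
  xi \in limg E0 -> xi != 0 -> E0 (Es ord0 xi) = a *: xi -> nu Phi = a^-1.
Proof.
move=> xi_in xi0 xia; rewrite /nu (lfun_trace_line (a := a) xi0) // => [v|].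
  by rewrite comp_lfunE E0_line.
by rewrite comp_lfunE.
Qed.

(** Applying E_0 to E*_i E_0 E*_0 xi = rho*(E*_i) E*_0 xi, and moving E_0
    through rho*(E*_i), gives m_0 m_i xi = m_0 rho*(E*_i) xi. *)
Lemma Amap_eigenvalue (M Ms : {vspace 'End(V)})
    (rhos : {linear subvs_of Ms -> subvs_of M}) (m : 'I_d.+1 -> F) (xi : V) :
    is_generated_by M (idE Phi) -> is_generated_by Ms Es ->
    is_rhos Phi rhos -> xi \in limg E0 -> m ord0 != 0 ->
    (forall i, E0 (Es i xi) = m i *: xi) ->
  forall i, Amap Phi rhos i xi = (nu Phi * m i) *: xi.
Proof.
move=> genM genMs rhosP xi_in m0 mE i.
have [_ EsMs _] := genMs.
set B := vsval (rhos (vsproj Ms (Es i))).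
have BE : (B \o E0 = E0 \o B)%VF.
  apply: (generated_commutes genM) (subvsP _) => j.
  by rewrite !idE_orth eq_sym; case: eqP => [->|]; rewrite ?scale0r.
have /lfunP/(_ xi) := rhosP (vsproj Ms (Es i)).
rewrite vsprojK ?EsMs // -/B !comp_lfunE mE linearZ => /(congr1 E0).
rewrite linearZ /= mE -[E0 (B _)]comp_lfunE -BE comp_lfunE mE linearZ /=.
rewrite [B (_ *: _)]linearZ /= scalerA [m i * _]mulrC -[in LHS]scalerA.
by move=> /(scalerI m0) Bxi; rewrite /Amap lfunE /= -/B -Bxi scalerA.
Qed.

Variables (dagger : {linear 'End(V) -> 'End(V)}).
Variable form : {bilinear V -> V -> F | *%R & *%R}.

Lemma form_EsEs (m : 'I_d.+1 -> F) (xi zeta : V) (i j : 'I_d.+1) :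
    is_dagger Phi dagger -> is_invariant_form dagger form ->
    xi \in limg E0 -> E0 (Es i zeta) = m i *: zeta ->
  form (Es i xi) (Es j zeta) = (i == j)%:R * (m i * form xi zeta).
Proof.
move=> [_ dagE dagEs] [_ inv] xi_in mE.
rewrite inv dagEs -comp_lfunE idEs_orth scale_lfunE linearZ /=.
by rewrite -{1}(E0_fixes xi_in) inv dagE mE linearZ.
Qed.

Lemma partners_line (xi zeta : V) :
    nu Phi != 0 -> xi \in limg E0 -> xi != 0 -> zeta \in limg E0 ->
  form xi zeta = nu Phi <-> partners Phi form xi zeta.
Proof.
move=> nu0 xi_in xi0; rewrite (rank1_limg (idE_rank Phi ord0) xi_in xi0).
move=> /vlineP[c ->]; split; last by case.
rewrite linearZ /= => cN.
(* c and <xi, xi> are nonzero because their product is nu. *)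
have /andP[c0 N0] : (c != 0) && (form xi xi != 0).
  by rewrite -negb_or -mulf_eq0 cN.
split; first by rewrite linearZ.
  by rewrite -cN mulfK.
rewrite !linearZ /= linearZl_LR /= cN scalerA.
by rewrite mulrA divff ?mulf_neq0 // scale1r.
Qed.

End IdempotentSystem.

Theorem lemma17p7 (F : fieldType) (d : nat) (V : vectType F)
    (dimV : \dim {:V} = d.+1)
    (Phi : idempotent_system V d)
    (dagger : {linear 'End(V) -> 'End(V)})
    (dagger_Phi : is_dagger Phi dagger)
    (M Ms : {vspace 'End(V)})
    (genM : is_generated_by M (idE Phi))
    (genMs : is_generated_by Ms (idEs Phi))
    (rhos : {linear subvs_of Ms -> subvs_of M})
    (rhosP : is_rhos Phi rhos)
    (k : 'I_d.+1 -> F)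
    (kP : forall i, (Amap Phi rhos i \o idE Phi ord0)%VF = k i *: idE Phi ord0)
    (form : {bilinear V -> V -> F | *%R & *%R})
    (formP : is_invariant_form dagger form)
    (xi zeta : V)
    (xi_in : xi \in limg (idE Phi ord0)) (xi_neq0 : xi <> 0)
    (zeta_in : zeta \in limg (idE Phi ord0)) (zeta_neq0 : zeta <> 0) :
  dual_bases form (fun i => idEs Phi i xi)
                  (fun i => (k i)^-1 *: idEs Phi i zeta)
  <-> partners Phi form xi zeta.
Proof.
have xi0 : xi != 0 by apply/eqP.
have [m m_neq0 mE] := E0Es_eigenvalue xi_in xi0.
have nuE : nu Phi = (m ord0)^-1 by apply: nu_eigenvalue xi_in xi0 (mE _ _ xi_in).
have nu0 : nu Phi != 0 by rewrite nuE invr_neq0.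
have kE i : k i = nu Phi * m i.
  have /lfunP/(_ xi) := kP i.
  rewrite comp_lfunE [RHS]scale_lfunE (E0_fixes xi_in).
  rewrite (Amap_eigenvalue (m := m) genM genMs rhosP xi_in) //; last first.
    by move=> j; apply: mE.
  move/eqP; rewrite -subr_eq0 -scalerBl scaler_eq0 (negPf xi0) orbF subr_eq0.
  by move/eqP.
have gram i j : form (idEs Phi i xi) ((k j)^-1 *: idEs Phi j zeta)
    = (i == j)%:R * ((nu Phi)^-1 * form xi zeta).
  rewrite linearZ /= (form_EsEs j dagger_Phi formP xi_in (mE i _ zeta_in)) kE.
  case: eqP => [<-|_]; last by rewrite !mul0r mulr0.
  by rewrite !mul1r mulrA invfM mulfVK.
apply: iff_trans (partners_line form nu0 xi_in xi0 zeta_in); split.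
  case=> _ _ /(_ ord0 ord0); rewrite gram eqxx mul1r => /(canRL (mulVKf nu0)).
  by rewrite mulr1.
move=> xz; apply: biorthogonal_basis => // i j.
by rewrite gram xz mulVf ?mulr1.
Qed.
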